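(* Let $\mathbb{F}$ be a commutative field of characteristic $0$ and let $f:\mathbb{R}^2 \to \mathbb{F}^2$ preserve unit distance. If $P,Q,X,Y \in \mathbb{R}^2$ and $\overrightarrow{PQ}$ is perpendicular to $\overrightarrow{XY}$, then $\overrightarrow{f(P)f(Q)}$ is perpendicular to $\overrightarrow{f(X)f(Y)}$.
   Context: For $u=(u_1,u_2)$, $v=(v_1,v_2)\in\mathbb{F}^2$, $\varphi_2(u,v)=(u_1-v_1)^2+(u_2-v_2)^2\in\mathbb{F}$. A map $f:\mathbb{R}^2\to\mathbb{F}^2$ preserves unit distance if for all $x,y\in\mathbb{R}^2$, $|x-y|=1$ (Euclidean distance) implies $\varphi_2(f(x),f(y))=1$. For points $P,Q$ (of $\mathbb{R}^2$ or of $\mathbb{F}^2$), $\overrightarrow{PQ}=Q-P$. Vectors $u=(u_1,u_2)$ and $v=(v_1,v_2)$ (in $\mathbb{R}^2$ or in $\mathbb{F}^2$) are perpendicular if $u_1v_1+u_2v_2=0$; the zero vector is allowed. *)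

(* Defs.v *)
From mathcomp Require Import all_boot all_order all_algebra.
From mathcomp Require Import reals.

Set Implicit Arguments.
Unset Strict Implicit.
Unset Printing Implicit Defensive.

Import Order.TTheory GRing.Theory Num.Theory.
Local Open Scope ring_scope.

(* Points and vectors of K^2 are row vectors 'rV[K]_2, with first coordinate
   u 0 0 and second coordinate u 0 1; the vector from P to Q is Q - P. *)

Definition phi2 (K : pzRingType) (u v : 'rV[K]_2) : K :=
  (u 0 0 - v 0 0) ^+ 2 + (u 0 1 - v 0 1) ^+ 2.

(* The library norm on 'rV[R]_2 is the sup norm, hence this definition. *)
Definition euclidean_dist (R : realType) (x y : 'rV[R]_2) : R :=
  Num.sqrt ((x 0 0 - y 0 0) ^+ 2 + (x 0 1 - y 0 1) ^+ 2).

Definition preserves_unit_distance (R : realType) (F : fieldType)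
    (f : 'rV[R]_2 -> 'rV[F]_2) : Prop :=
  forall x y : 'rV[R]_2, euclidean_dist x y = 1 -> phi2 (f x) (f y) = 1.

Definition perpendicular (K : pzRingType) (u v : 'rV[K]_2) : Prop :=
  u 0 0 * v 0 0 + u 0 1 * v 0 1 = 0.

(* Main.v *)
Require Import Defs.
From HB Require Import structures.
From mathcomp Require Import all_boot all_order all_algebra.
From mathcomp Require Import reals.
From mathcomp Require Import ring lra.

(** The map f turns out to be an additive map L up to translation, and L is
    rigid enough on each line to preserve right angles.

    Affinity.  Two circles of nonzero radius in F^2 with distinct centres c, d
    meet in at most two points p, q, and then p + q = c + d; isotropic vectors
    c - d do no harm, since the circles are then disjoint ([two_circles]).
    Hence a rhombus made of two unit equilateral triangles goes to a
    parallelogram unless its two far vertices collapse, and the Moser spindle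
    rules the collapse out ([rhombus60]).  Two such rhombi overlap to show that
    f is affine along unit steps, so natural distances are preserved, then
    unit fractions by similar triangles, then all rational distances.
    Triangles with sides n, n + 1 and the given segment make f injective.  With
    injectivity [two_circles] applies to every rhombus of natural side, and as
    any two vectors are sums of sides of one common length, f (x + v) - f x
    depends on v only ([increment_translation]): f - f 0 is an additive map L.

    Right angles.  If a and b are perpendicular and |a|^2 + |b|^2 is the square
    of a rational, then a + b and a - b have the same rational length, so
    L (a + b) and L (a - b) have equal norms and L a, L b are perpendicular.
    Fix a unit vector e.  For s'^2 = s^2 + 1 there is a t <> 0 such that both
    s^2 + t^2 and s'^2 + t^2 are squares of rationals, so L (s e) and L (s' e)
    are both perpendicular to the image of the vector of length t orthogonal to
    e, hence parallel to each other ([line_succ_square]).  Therefore, for a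
    fixed a <> 0, the set of s with L (s e) parallel to L (a e) is an additive
    group closed under s |-> sqrt (s^2 + 1); it is closed under inversion too,
    because (s^-1 + s)/2 and (s^-1 - s)/2 have squares that differ by 1.  Such a
    group contains 1 ([inversion_closed_contains_1]), so L maps each line
    through 0 into a line, and perpendicularity for arbitrary lengths reduces to
    unit vectors e, e', where it follows from the 3-4-5 triangle. *)
Set Implicit Arguments.
Unset Strict Implicit.
Unset Printing Implicit Defensive.

Import Order.TTheory GRing.Theory Num.Theory.
Local Open Scope ring_scope.

(** * Plane vectors over a field *)

Definition dot (K : pzRingType) (u v : 'rV[K]_2) : K :=
  u 0 0 * v 0 0 + u 0 1 * v 0 1.

Definition cross (K : pzRingType) (u v : 'rV[K]_2) : K :=
  u 0 0 * v 0 1 - u 0 1 * v 0 0.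

Definition turn (K : pzRingType) (u : 'rV[K]_2) : 'rV[K]_2 :=
  \row_j (if j == 0 then - u 0 1 else u 0 0).

Notation nsq u := (dot u u).

Ltac vec := apply/rowP=> ?; rewrite !mxE; ring.
Ltac coords := rewrite /dot /cross ?mxE /=; ring.

Lemma row2P (K : pzRingType) (u v : 'rV[K]_2) :
  u 0 0 = v 0 0 -> u 0 1 = v 0 1 -> u = v.
Proof.
move=> e0 e1; apply/rowP=> -[[|[|//]] i2]; rewrite ?ord1.
- by rewrite (_ : Ordinal i2 = 0) //; apply/val_inj.
- by rewrite (_ : Ordinal i2 = 1) //; apply/val_inj.
Qed.

Lemma phi2E (K : comPzRingType) (u v : 'rV[K]_2) : phi2 u v = nsq (u - v).
Proof. by rewrite /phi2; coords. Qed.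

Lemma dotC (K : comPzRingType) (u v : 'rV[K]_2) : dot u v = dot v u.
Proof. by coords. Qed.

Lemma nsqB (K : comPzRingType) (u v : 'rV[K]_2) : nsq (u - v) = nsq (v - u).
Proof. by coords. Qed.

Lemma nsqN (K : comPzRingType) (u : 'rV[K]_2) : nsq (- u) = nsq u.
Proof. by coords. Qed.

Lemma nsqZ (K : comPzRingType) (k : K) (u : 'rV[K]_2) :
  nsq (k *: u) = k ^+ 2 * nsq u.
Proof. by coords. Qed.

Lemma nsq0 (K : comPzRingType) : nsq (0 : 'rV[K]_2) = 0.
Proof. by coords. Qed.

Lemma nsq_parallelogram (K : comPzRingType) (u v : 'rV[K]_2) :
  nsq (u + v) + nsq (u - v) = 2 * nsq u + 2 * nsq v.
Proof. by coords. Qed.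

Lemma nsq_polarization (K : comPzRingType) (u v : 'rV[K]_2) :
  nsq (u + v) - nsq (u - v) = 4 * dot u v.
Proof. by coords. Qed.

Lemma nsq_turn (K : comPzRingType) (s t : K) (u : 'rV[K]_2) :
  nsq (s *: u + t *: turn u) = (s ^+ 2 + t ^+ 2) * nsq u.
Proof. by coords. Qed.

Lemma row2_neq0 (K : pzRingType) (u : 'rV[K]_2) :
  u != 0 -> (u 0 0 != 0) || (u 0 1 != 0).
Proof.
apply: contraNT; rewrite negb_or !negbK => /andP[/eqP e0 /eqP e1].
by apply/eqP/row2P; rewrite ?e0 ?e1 mxE.
Qed.

(** Cancelling one nonzero coordinate of [u] is enough, so this holds for
    isotropic [u] as well. *)
Lemma dot_parallel (K : fieldType) (u v w : 'rV[K]_2) :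
  u != 0 -> cross u v = 0 -> dot u w = 0 -> dot v w = 0.
Proof.
move=> /row2_neq0/orP[] u_neq0 uv uw; apply: (mulfI u_neq0); rewrite mulr0.
- have -> : u 0 0 * dot v w = v 0 0 * dot u w + w 0 1 * cross u v by coords.
  by rewrite uv uw !mulr0 addr0.
- have -> : u 0 1 * dot v w = v 0 1 * dot u w - w 0 0 * cross u v by coords.
  by rewrite uv uw !mulr0 subr0.
Qed.

Lemma cross_trans (K : fieldType) (u v w : 'rV[K]_2) :
  u != 0 -> cross u v = 0 -> cross u w = 0 -> cross v w = 0.
Proof.
have E z : cross z w = - dot z (turn w) by coords.
rewrite !E => u_neq0 uv /eqP; rewrite oppr_eq0 => /eqP uw.
by rewrite (dot_parallel u_neq0 uv uw) oppr0.
Qed.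

(** In dimension 2 the orthogonal of a nonzero vector is a line, even when the
    vector is isotropic and lies on it. *)
Lemma cross_perp (K : fieldType) (u v w : 'rV[K]_2) :
  w != 0 -> dot u w = 0 -> dot v w = 0 -> cross u v = 0.
Proof.
move=> w_neq0 uw vw.
have -> : cross u v = dot (turn u) v by coords.
apply: (dot_parallel w_neq0); last by rewrite dotC.
by rewrite -uw; coords.
Qed.

Lemma dot_cross_eq0 (K : fieldType) (u z : 'rV[K]_2) :
  nsq z != 0 -> dot u z = 0 -> cross u z = 0 -> u = 0.
Proof.
move=> z_neq0 d0 c0; apply: row2P; rewrite mxE; apply: (mulIf z_neq0).
- have -> : u 0 0 * nsq z = dot u z * z 0 0 + cross u z * z 0 1 by coords.
  by rewrite d0 c0 !mul0r addr0.
- have -> : u 0 1 * nsq z = dot u z * z 0 1 - cross u z * z 0 0 by coords.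
  by rewrite d0 c0 !mul0r subr0.
Qed.

(** The vectors x = p - q, y = p + q - c - d and z = c - d are pairwise
    orthogonal.  If z is anisotropic, one of x and y vanishes.  If z is
    isotropic, then x, y and z are all multiples of z, and so is
    2 (p - c) = x + y - z, which makes the radius r vanish. *)
Lemma two_circles (K : fieldType) (r : K) (p q c d : 'rV[K]_2) :
  2 != 0 :> K -> r != 0 -> c != d ->
  nsq (p - c) = r -> nsq (p - d) = r -> nsq (q - c) = r -> nsq (q - d) = r ->
  q = p \/ p + q = c + d.
Proof.
move=> two r_neq0 cd pc pd qc qd.
pose x := p - q; pose y := p + q - (c + d); pose z := c - d.
have z_neq0 : z != 0 by rewrite subr_eq0.
have xz : dot x z = 0.
  apply: (mulfI two); rewrite mulr0.
  transitivity (nsq (p - d) - nsq (p - c) - (nsq (q - d) - nsq (q - c))).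
    by rewrite /x /z; coords.
  by rewrite pc pd qc qd; ring.
have yz : dot y z = 0.
  apply: (mulfI two); rewrite mulr0.
  transitivity (nsq (p - d) - nsq (p - c) + (nsq (q - d) - nsq (q - c))).
    by rewrite /y /z; coords.
  by rewrite pc pd qc qd; ring.
have xy : dot x y = 0.
  apply: (mulfI two); rewrite mulr0.
  transitivity (nsq (p - d) + nsq (p - c) - (nsq (q - d) + nsq (q - c))).
    by rewrite /x /y; coords.
  by rewrite pc pd qc qd; ring.
have [z_iso|z_aniso] := eqVneq (nsq z) 0.
- have xcz := cross_perp z_neq0 xz z_iso.
  have ycz := cross_perp z_neq0 yz z_iso.
  have zm : cross z (p - c) = 0.
    apply: (mulfI two); rewrite mulr0.
    transitivity (- (cross x z + cross y z)); first by rewrite /x /y /z; coords.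
    by rewrite xcz ycz addr0 oppr0.
  have mz := dot_parallel z_neq0 zm z_iso.
  rewrite dotC in mz.
  by rewrite -pc (dot_parallel z_neq0 zm mz) eqxx in r_neq0.
- have /eqP : cross x z * cross y z = 0.
    transitivity (dot x y * nsq z - dot x z * dot y z); first by coords.
    by rewrite xy xz !mul0r subr0.
  rewrite mulf_eq0 => /orP[] /eqP c0.
  + left; apply/eqP; rewrite eq_sym -subr_eq0.
    by apply/eqP; exact: dot_cross_eq0 z_aniso xz c0.
  + right; apply/eqP; rewrite -subr_eq0.
    by apply/eqP; exact: dot_cross_eq0 z_aniso yz c0.
Qed.

(** * Triangles in the Euclidean plane *)

Lemma nsq_ge0 (R : realDomainType) (u : 'rV[R]_2) : 0 <= nsq u.
Proof. by rewrite /dot -!expr2 addr_ge0 ?sqr_ge0. Qed.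

Lemma nsq_eq0 (R : realDomainType) (u : 'rV[R]_2) : (nsq u == 0) = (u == 0).
Proof.
apply/eqP/eqP => [|->]; last exact: nsq0.
move=> /eqP; rewrite /dot -!expr2 paddr_eq0 ?sqr_ge0 // !sqrf_eq0.
by case/andP => /eqP e0 /eqP e1; apply: row2P; rewrite ?e0 ?e1 mxE.
Qed.

(** The inequality is the nonnegativity of sixteen times the squared area in
    Heron's formula, written with squared side lengths. *)
Lemma triangle_exists (R : rcfType) (v : 'rV[R]_2) (a b : R) :
  v != 0 -> (nsq v + a - b) ^+ 2 <= 4 * nsq v * a ->
  exists u, nsq u = a /\ nsq (v - u) = b.
Proof.
move=> v_neq0 heron; have v_gt0 : 0 < nsq v.
  by rewrite lt_def nsq_eq0 v_neq0 nsq_ge0.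
have v_unit : nsq v != 0 by rewrite gt_eqF.
pose s := (nsq v + a - b) / (2 * nsq v).
pose t := Num.sqrt (a / nsq v - s ^+ 2).
have t2 : t ^+ 2 = a / nsq v - s ^+ 2.
  rewrite sqr_sqrtr // /s.
  have -> : a / nsq v - ((nsq v + a - b) / (2 * nsq v)) ^+ 2
     = (4 * nsq v * a - (nsq v + a - b) ^+ 2) / (4 * nsq v ^+ 2) by field.
  by rewrite divr_ge0 ?subr_ge0 // mulr_ge0 ?sqr_ge0.
exists (s *: v + t *: turn v); split.
  by rewrite nsq_turn t2; field.
have -> : v - (s *: v + t *: turn v) = (1 - s) *: v + (- t) *: turn v by vec.
by rewrite nsq_turn sqrrN t2 /s; field.
Qed.

Lemma isosceles_exists (R : rcfType) (v : 'rV[R]_2) (r : R) :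
  nsq v <= 4 * r ^+ 2 ->
  exists u w, [/\ v = u + w, nsq u = r ^+ 2 & nsq w = r ^+ 2].
Proof.
have [->|v_neq0] := eqVneq v 0.
  move=> _; exists (r *: delta_mx 0 0), (- (r *: delta_mx 0 0)).
  have e : nsq (r *: delta_mx 0 0 : 'rV[R]_2) = r ^+ 2.
    by rewrite nsqZ /dot !mxE /=; ring.
  by rewrite subrr nsqN e.
move=> v_le; have [|u [ur vur]] := @triangle_exists _ v (r ^+ 2) (r ^+ 2) v_neq0.
  have -> : 4 * nsq v * r ^+ 2 = nsq v * (4 * r ^+ 2) by ring.
  by rewrite addrK expr2 ler_wpM2l ?nsq_ge0.
by exists u, (v - u); rewrite addrC subrK.
Qed.

(** * Unit distance preserving maps are affine on rational steps *)

Definition unit_preserving (R F : pzRingType) (f : 'rV[R]_2 -> 'rV[F]_2) :=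
  forall x y, nsq (x - y) = 1 -> nsq (f x - f y) = 1.

Lemma pchar0_natr_neq0 (F : fieldType) (n : nat) :
  [pchar F] =i pred0 -> n != 0%N -> n%:R != 0 :> F.
Proof. by move=> /pcharf0P ->. Qed.

Lemma unit_preserving_step (R F : pzRingType) (f : 'rV[R]_2 -> 'rV[F]_2) x v :
  unit_preserving f -> nsq v = 1 -> nsq (f (x + v) - f x) = 1.
Proof. by move=> f_unit v1; apply: f_unit; rewrite addrC addKr. Qed.

(** The images of the ends of the long diagonal lie on both unit circles centred
    at the images of the ends of the short one. *)
Lemma rhombus60_dichotomy (R F : fieldType) (f : 'rV[R]_2 -> 'rV[F]_2) x u w :
  [pchar F] =i pred0 -> unit_preserving f ->
  nsq u = 1 -> nsq w = 1 -> nsq (u - w) = 1 ->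
  f (x + u + w) = f x \/ f x + f (x + u + w) = f (x + u) + f (x + w).
Proof.
move=> F0 f_unit u1 w1 uw1.
have cd : nsq (f (x + u) - f (x + w)) = 1.
  by apply: f_unit; rewrite -uw1; congr dot; vec.
apply: (@two_circles _ 1) => //; first exact: pchar0_natr_neq0.
- exact: oner_neq0.
- by apply/eqP => e; move/eqP: cd; rewrite e subrr nsq0 eq_sym oner_eq0.
- by rewrite nsqB; exact: unit_preserving_step.
- by rewrite nsqB; exact: unit_preserving_step.
- exact: unit_preserving_step.
- by rewrite addrAC; exact: unit_preserving_step.
Qed.

(** The long diagonal of a rhombus made of two unit equilateral triangles has
    length sqrt 3. *)
Lemma sqrt3_dichotomy (R : rcfType) (F : fieldType)
    (f : 'rV[R]_2 -> 'rV[F]_2) x v :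
  [pchar F] =i pred0 -> unit_preserving f -> nsq v = 3 ->
  f (x + v) = f x \/ nsq (f (x + v) - f x) = 3.
Proof.
move=> F0 f_unit v3.
have [|u [w [vE]]] := @isosceles_exists _ v 1; first by rewrite v3; lra.
rewrite expr1n => u1 w1.
have uw1 : nsq (u - w) = 1.
  have := nsq_parallelogram u w; rewrite -vE u1 w1 v3 => e; lra.
rewrite vE addrA.
have [|e] := rhombus60_dichotomy x F0 f_unit u1 w1 uw1; [by left|right].
have cd : nsq (f (x + u) - f (x + w)) = 1.
  by apply: f_unit; rewrite -uw1; congr dot; vec.
have := nsq_parallelogram (f (x + u) - f x) (f (x + w) - f x).
rewrite !unit_preserving_step //.
have -> : f (x + u) - f x + (f (x + w) - f x) = f (x + u + w) - f x.
  by rewrite addrACA -e addrACA subrr add0r.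
have -> : f (x + u) - f x - (f (x + w) - f x) = f (x + u) - f (x + w).
  by rewrite opprB addrA subrK.
by rewrite cd => /(canRL (addrK _)) ->; ring.
Qed.

(** The Moser spindle: if the two ends of v collapse, swing v around x to a
    vector u of the same length with |v - u| = 1.  The unit distance from
    f (x + v) = f x to f (x + u) contradicts [sqrt3_dichotomy], as 1 differs
    from 0 and from 3. *)
Lemma sqrt3_separated (R : rcfType) (F : fieldType)
    (f : 'rV[R]_2 -> 'rV[F]_2) x v :
  [pchar F] =i pred0 -> unit_preserving f -> nsq v = 3 -> f (x + v) <> f x.
Proof.
move=> F0 f_unit v3 e.
have v_neq0 : v != 0 by rewrite -nsq_eq0 v3 pnatr_eq0.
have [|u [u3 vu1]] := @triangle_exists _ v 3 1 v_neq0; first by rewrite v3; lra.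
have : nsq (f (x + v) - f (x + u)) = 1.
  by apply: f_unit; rewrite -vu1; congr dot; vec.
rewrite e nsqB.
have [->|->] := sqrt3_dichotomy x F0 f_unit u3.
  by rewrite subrr nsq0 => /eqP; rewrite eq_sym oner_eq0.
move=> /eqP; rewrite -subr_eq0.
have -> : 3 - 1 = 2%:R :> F by ring.
by apply/negP; exact: pchar0_natr_neq0.
Qed.

Lemma rhombus60 (R : rcfType) (F : fieldType)
    (f : 'rV[R]_2 -> 'rV[F]_2) x u w :
  [pchar F] =i pred0 -> unit_preserving f ->
  nsq u = 1 -> nsq w = 1 -> nsq (u - w) = 1 ->
  f (x + u + w) = f (x + u) + f (x + w) - f x.
Proof.
move=> F0 f_unit u1 w1 uw1.
have [e|<-] := rhombus60_dichotomy x F0 f_unit u1 w1 uw1; last first.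
  by rewrite [RHS]addrAC subrr add0r.
have uw3 : nsq (u + w) = 3.
  have := nsq_parallelogram u w; rewrite u1 w1 uw1 => {}e; lra.
by case: (@sqrt3_separated _ _ f x _ F0 f_unit uw3); rewrite addrA.
Qed.

(** Take u with w, u and w - u of unit length.  The rhombi of sides w, u at x
    and of sides w - u, w at x + u share the vertices x + w and x + w + u; the
    second one ends at x + w + w. *)
Lemma unit_step_twice (R : rcfType) (F : fieldType)
    (f : 'rV[R]_2 -> 'rV[F]_2) x w :
  [pchar F] =i pred0 -> unit_preserving f -> nsq w = 1 ->
  f (x + w + w) - f (x + w) = f (x + w) - f x.
Proof.
move=> F0 f_unit w1.
have w_neq0 : w != 0 by rewrite -nsq_eq0 w1 oner_eq0.
have [|u [u1 wu1]] := @triangle_exists _ w 1 1 w_neq0; first by rewrite w1; lra.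
have e1 := rhombus60 x F0 f_unit w1 u1 wu1.
have := rhombus60 (x + u) F0 f_unit wu1 w1.
rewrite addrAC subrr add0r nsqN u1 => /(_ erefl).
have -> : x + u + (w - u) = x + w by vec.
by rewrite (addrAC x u w) e1 => ->; vec.
Qed.

Lemma unit_steps (R : rcfType) (F : fieldType)
    (f : 'rV[R]_2 -> 'rV[F]_2) x w n :
  [pchar F] =i pred0 -> unit_preserving f -> nsq w = 1 ->
  f (x + n%:R *: w) = f x + n%:R *: (f (x + w) - f x).
Proof.
move=> F0 f_unit w1.
have step m : f (x + m.+1%:R *: w) - f (x + m%:R *: w) = f (x + w) - f x.
  elim: m => [|m IH]; first by rewrite scale1r scale0r addr0.
  have E k : x + k.+1%:R *: w = x + k%:R *: w + w by vec.
  by rewrite -IH (E m.+1) (E m); exact: unit_step_twice.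
elim: n => [|n IH]; first by rewrite !scale0r !addr0.
by move/eqP: (step n); rewrite subr_eq => /eqP ->; rewrite IH; vec.
Qed.

(** Join x and y to an apex z at unit distance from both and enlarge the triangle
    k + 1 times from z: its base becomes a unit segment, and f commutes with the
    enlargement by [unit_steps]. *)
Lemma preserves_unit_fraction (R : rcfType) (F : fieldType)
    (f : 'rV[R]_2 -> 'rV[F]_2) k x y :
  [pchar F] =i pred0 -> unit_preserving f ->
  nsq (x - y) = k.+1%:R ^- 2 -> nsq (f x - f y) = k.+1%:R ^- 2.
Proof.
move=> F0 f_unit xy.
have kF : k.+1%:R != 0 :> F by exact: pchar0_natr_neq0.
have kR : k.+1%:R != 0 :> R by rewrite pnatr_eq0.
have [|u [w [xyE u1 w1]]] := @isosceles_exists _ (x - y) 1.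
  rewrite xy expr1n mulr1; have : k.+1%:R ^- 2 <= 1 :> R.
    by rewrite -exprVn exprn_ile1 ?invr_ge0 ?ler0n ?invf_le1 ?ltr0Sn // ler1n.
  by move=> /le_trans; apply; rewrite ler1n.
rewrite expr1n in u1; rewrite expr1n -nsqN in w1.
pose z := y - (- w).
have xE : x = z + u by rewrite /z -(subrK y x) xyE; vec.
have yE : y = z + - w by rewrite /z; vec.
have : nsq (f (z + k.+1%:R *: u) - f (z + k.+1%:R *: (- w))) = 1.
  apply: f_unit.
  have -> : z + k.+1%:R *: u - (z + k.+1%:R *: - w) = k.+1%:R *: (x - y).
    by rewrite xyE; vec.
  by rewrite nsqZ xy mulfV // expf_neq0.
rewrite !unit_steps // -xE -yE.
have -> : f z + k.+1%:R *: (f x - f z) - (f z + k.+1%:R *: (f y - f z)) =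
          k.+1%:R *: (f x - f y) by vec.
rewrite nsqZ => e; apply: (mulfI (expf_neq0 2 kF)).
by rewrite e mulfV // expf_neq0.
Qed.

(** Preserving the distance 1/k amounts to [rescale k f] preserving the distance
    1. *)
Definition rescale (R F : fieldType) (k : nat) (f : 'rV[R]_2 -> 'rV[F]_2) x :=
  k%:R *: f (k%:R^-1 *: x).

Lemma rescale_unit_preserving (R : rcfType) (F : fieldType) k
    (f : 'rV[R]_2 -> 'rV[F]_2) :
  [pchar F] =i pred0 -> unit_preserving f -> unit_preserving (rescale k.+1 f).
Proof.
move=> F0 f_unit x y xy.
rewrite /rescale -scalerBr nsqZ (@preserves_unit_fraction _ _ f k) //.
  by rewrite mulfV // expf_neq0 // pchar0_natr_neq0.
by rewrite -scalerBr nsqZ xy mulr1 exprVn.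
Qed.

Lemma preserves_natural (R : rcfType) (F : fieldType)
    (f : 'rV[R]_2 -> 'rV[F]_2) n x y :
  [pchar F] =i pred0 -> unit_preserving f ->
  nsq (x - y) = n%:R ^+ 2 -> nsq (f x - f y) = n%:R ^+ 2.
Proof.
move=> F0 f_unit; case: n => [|n] xy.
  move: xy; rewrite !expr0n /= => /eqP; rewrite nsq_eq0 subr_eq0 => /eqP ->.
  by rewrite subrr nsq0.
have nR : n.+1%:R != 0 :> R by rewrite pnatr_eq0.
pose w := n.+1%:R^-1 *: (x - y).
have w1 : nsq w = 1 by rewrite nsqZ xy exprVn mulVf // expf_neq0.
have -> : x = y + n.+1%:R *: w by rewrite scalerA mulfV // scale1r addrC subrK.
rewrite unit_steps // addrAC subrr add0r nsqZ.
by rewrite unit_preserving_step // mulr1.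
Qed.

Lemma preserves_rational (R : rcfType) (F : fieldType)
    (f : 'rV[R]_2 -> 'rV[F]_2) n k x y :
  [pchar F] =i pred0 -> unit_preserving f ->
  nsq (x - y) = (n%:R / k.+1%:R) ^+ 2 ->
  nsq (f x - f y) = (n%:R / k.+1%:R) ^+ 2.
Proof.
move=> F0 f_unit xy.
have kF : k.+1%:R != 0 :> F by exact: pchar0_natr_neq0.
have kR : k.+1%:R != 0 :> R by rewrite pnatr_eq0.
have := @preserves_natural _ _ (rescale k.+1 f) n
  (k.+1%:R *: x) (k.+1%:R *: y) F0 (rescale_unit_preserving k F0 f_unit).
rewrite /rescale !scalerA !mulVf // !scale1r -!scalerBr !nsqZ xy.
rewrite -exprMn mulrCA mulfV // mulr1 => /(_ erefl) e.
by apply: (mulfI (expf_neq0 2 kF)); rewrite e -exprMn mulrCA mulfV // mulr1.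
Qed.

(** Otherwise the triangle on v with sides n and n + 1 would give two points of
    F^2 whose squared distance is both n^2 and (n + 1)^2. *)
Lemma separates_far_points (R : realType) (F : fieldType)
    (f : 'rV[R]_2 -> 'rV[F]_2) x v :
  [pchar F] =i pred0 -> unit_preserving f -> 1 <= nsq v -> f (x + v) <> f x.
Proof.
move=> F0 f_unit v_ge1 e.
have v_neq0 : v != 0 by rewrite -nsq_eq0 gt_eqF // (lt_le_trans ltr01).
pose N := Num.bound (nsq v).
have vN : nsq v < N%:R by exact: archi_boundP (nsq_ge0 v).
have [|u [uN vuN]] := @triangle_exists _ v (N%:R ^+ 2) (N.+1%:R ^+ 2) v_neq0.
  move: v_ge1 vN; rewrite -natr1; move: (nsq v) (N%:R : R) => L M L1 LM.
  have h1 : (L + M ^+ 2 - (M + 1) ^+ 2) ^+ 2 <= 4 * M ^+ 2 by nra.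
  by apply: le_trans h1 _; nra.
have e1 : nsq (f (x + u) - f x) = N%:R ^+ 2.
  by apply: preserves_natural => //; rewrite -uN; congr dot; vec.
have : nsq (f (x + v) - f (x + u)) = N.+1%:R ^+ 2.
  by apply: preserves_natural => //; rewrite -vuN; congr dot; vec.
rewrite e nsqB e1 => /eqP; rewrite -subr_eq0 -oppr_eq0 opprB.
have -> : N.+1%:R ^+ 2 - N%:R ^+ 2 = (2 * N + 1)%N%:R :> F.
  by rewrite natrD natrM -natr1; ring.
by apply/negP/pchar0_natr_neq0; rewrite ?addn1.
Qed.

(** Two points too close for [separates_far_points] are pulled apart by
    rescaling. *)
Lemma unit_preserving_inj (R : realType) (F : fieldType)
    (f : 'rV[R]_2 -> 'rV[F]_2) :
  [pchar F] =i pred0 -> unit_preserving f -> injective f.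
Proof.
move=> F0 f_unit x y fxy; apply/eqP; rewrite -subr_eq0 -nsq_eq0.
apply: contraT => v_neq0.
have v_gt0 : 0 < nsq (x - y) by rewrite lt_def v_neq0 nsq_ge0.
pose k := Num.bound (nsq (x - y))^-1.
have kR : k.+1%:R != 0 :> R by rewrite pnatr_eq0.
have k_gt : (nsq (x - y))^-1 <= k.+1%:R.
  apply/ltW/(@lt_trans _ _ k%:R); last by rewrite ltr_nat.
  by apply: archi_boundP; rewrite invr_ge0 ltW.
have [|//] := @separates_far_points _ _ _ (k.+1%:R *: y) (k.+1%:R *: (x - y)) F0
  (rescale_unit_preserving k F0 f_unit).
- have k_ge : 1 <= k.+1%:R * nsq (x - y).
    by rewrite -[leLHS](mulVf v_neq0) ler_wpM2r ?nsq_ge0.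
  rewrite nsqZ expr2 -mulrA (le_trans k_ge) // ler_peMl ?ler1n //.
  exact: le_trans k_ge.
- by rewrite scalerBr addrC subrK /rescale !scalerA mulVf // !scale1r fxy.
Qed.

Lemma rhombus (R : realType) (F : fieldType) (f : 'rV[R]_2 -> 'rV[F]_2) n x u w :
  [pchar F] =i pred0 -> unit_preserving f ->
  nsq u = n.+1%:R ^+ 2 -> nsq w = n.+1%:R ^+ 2 ->
  f (x + u + w) = f (x + u) + f (x + w) - f x.
Proof.
move=> F0 f_unit un wn.
have n_neq0 : n.+1%:R != 0 :> R by rewrite pnatr_eq0.
have [<-|uw] := eqVneq u w.
  (* here x + u = x + w is the midpoint of x and x + u + w *)
  pose d := n.+1%:R^-1 *: u.
  have d1 : nsq d = 1 by rewrite nsqZ un exprVn mulVf // expf_neq0.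
  have uE : u = n.+1%:R *: d by rewrite scalerA mulfV // scale1r.
  have -> : x + u + u = x + (2 * n.+1)%:R *: d by rewrite natrM uE; vec.
  by rewrite uE !unit_steps // natrM; vec.
have [uw0|uw0] := eqVneq (u + w) 0.
  (* here x + u + w = x, the midpoint of x + w and x + u *)
  have wE : w = - u by apply/eqP; rewrite -addr_eq0 addrC uw0.
  pose d := n.+1%:R^-1 *: u.
  have d1 : nsq d = 1 by rewrite nsqZ un exprVn mulVf // expf_neq0.
  have uE : u = n.+1%:R *: d by rewrite scalerA mulfV // scale1r.
  pose z := x - u.
  have -> : x + w = z by rewrite wE.
  have -> : x + u + w = z + n.+1%:R *: d by rewrite -uE wE; vec.
  have -> : x + u = z + (2 * n.+1)%:R *: d by rewrite natrM /z uE; vec.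
  have -> : x = z + n.+1%:R *: d by rewrite -uE subrK.
  by rewrite !unit_steps // natrM; vec.
have pres a b : nsq (a - b) = n.+1%:R ^+ 2 -> nsq (f a - f b) = n.+1%:R ^+ 2.
  exact: preserves_natural.
have inj := unit_preserving_inj F0 f_unit.
have [|||||||e|] := @two_circles _ (n.+1%:R ^+ 2) (f x) (f (x + u + w))
   (f (x + u)) (f (x + w)).
- exact: pchar0_natr_neq0.
- by rewrite expf_neq0 // pchar0_natr_neq0.
- by apply: contra uw => /eqP/inj/addrI ->.
- by apply: pres; rewrite -un nsqB; congr dot; vec.
- by apply: pres; rewrite -wn nsqB; congr dot; vec.
- by apply: pres; rewrite -wn; congr dot; vec.
- by apply: pres; rewrite -un; congr dot; vec.
- move: (inj _ _ e) => /eqP; rewrite -addrA -subr_eq0 addrAC subrr add0r.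
  by rewrite (negPf uw0).
- by move=> <-; rewrite [RHS]addrAC subrr add0r.
Qed.

(** Two opposite sides of a rhombus have the same image vector, so the increment
    along u is unchanged by a translation along any w with |w| = |u| natural.
    Arbitrary v and y are each the sum of two vectors of one common natural
    length. *)
Lemma increment_translation (R : realType) (F : fieldType)
    (f : 'rV[R]_2 -> 'rV[F]_2) x v y :
  [pchar F] =i pred0 -> unit_preserving f ->
  f (x + y + v) - f (x + y) = f (x + v) - f x.
Proof.
move=> F0 f_unit.
pose n := Num.bound (nsq v + nsq y).
have n_gt : nsq v + nsq y < n.+1%:R.
  apply: (@lt_trans _ _ n%:R); last by rewrite ltr_nat.
  by apply: archi_boundP; rewrite addr_ge0 ?nsq_ge0.
have n_ge1 : 1 <= n.+1%:R :> R by rewrite ler1n.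
have [|v1 [v2 [-> v1n v2n]]] := @isosceles_exists _ v n.+1%:R.
  by have := nsq_ge0 y; nra.
have [|y1 [y2 [-> y1n y2n]]] := @isosceles_exists _ y n.+1%:R.
  by have := nsq_ge0 v; nra.
have side a z u : nsq u = n.+1%:R ^+ 2 -> nsq z = n.+1%:R ^+ 2 ->
    f (a + z + u) - f (a + z) = f (a + u) - f a.
  by move=> un zn; rewrite (rhombus a F0 f_unit zn un); vec.
have sides a u : nsq u = n.+1%:R ^+ 2 ->
    f (a + (y1 + y2) + u) - f (a + (y1 + y2)) = f (a + u) - f a.
  by move=> un; rewrite addrA !side.
transitivity ((f (x + (y1 + y2) + v1 + v2) - f (x + (y1 + y2) + v1))
              + (f (x + (y1 + y2) + v1) - f (x + (y1 + y2)))).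
  by rewrite !addrA; vec.
by rewrite (sides x) // (addrAC x (y1 + y2)) (sides (x + v1)) // (addrA x); vec.
Qed.

(** * The linear part *)

Definition keeps_rational_lengths (R F : fieldType)
    (L : 'rV[R]_2 -> 'rV[F]_2) := forall n k v,
  nsq v = (n%:R / k.+1%:R) ^+ 2 -> nsq (L v) = (n%:R / k.+1%:R) ^+ 2.

Lemma unit_preserving_affine (R : realType) (F : fieldType)
    (f : 'rV[R]_2 -> 'rV[F]_2) :
  [pchar F] =i pred0 -> unit_preserving f ->
  exists L : {additive 'rV[R]_2 -> 'rV[F]_2},
   [/\ forall x y, f y - f x = L (y - x),
       forall v, L v = 0 -> v = 0
     & keeps_rational_lengths L].
Proof.
move=> F0 f_unit; pose L v := f v - f 0.
have fL x y : f y - f x = L (y - x).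
  have := increment_translation 0 (y - x) x F0 f_unit.
  by rewrite !add0r (addrC x) subrK.
have LB : zmod_morphism L by move=> u v; rewrite -fL /L; vec.
pose Ladd := GRing.isZmodMorphism.Build _ _ L LB.
exists (HB.pack_for {additive 'rV[R]_2 -> 'rV[F]_2} L Ladd); split=> //=.
- by move=> v /eqP; rewrite subr_eq0 => /eqP /(unit_preserving_inj F0 f_unit).
- by move=> n k v vE; apply: preserves_rational => //; rewrite subr0.
Qed.

(** The diagonals a + b and a - b of the rectangle have equal rational length,
    and 4 dot (L a) (L b) is the difference of the norms of their images. *)
Lemma perp_rational_hypotenuse (R F : fieldType)
    (L : {additive 'rV[R]_2 -> 'rV[F]_2}) n k a b :
  [pchar F] =i pred0 -> keeps_rational_lengths L ->
  dot a b = 0 -> nsq a + nsq b = (n%:R / k.+1%:R) ^+ 2 -> dot (L a) (L b) = 0.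
Proof.
move=> F0 Lrat ab hyp.
have four : 4 != 0 :> F by exact: pchar0_natr_neq0.
apply: (mulfI four); rewrite mulr0 -nsq_polarization -raddfD -raddfB.
rewrite (Lrat n k) ?(Lrat n k) ?subrr //.
- by transitivity (nsq a + nsq b - 2 * dot a b);
    [coords | rewrite ab mulr0 subr0 hyp].
- by transitivity (nsq a + nsq b + 2 * dot a b);
    [coords | rewrite ab mulr0 addr0 hyp].
Qed.

(** With r = (k + 1/k)/2 and r' = (k - 1/k)/2 one has r^2 - r'^2 = 1, so for k
    large some t <> 0 satisfies s'^2 + t^2 = r^2 and s^2 + t^2 = r'^2.  Both
    images are then orthogonal to the nonzero vector L (t e'), where e' is e
    turned by a right angle. *)
Lemma line_succ_square (R : realType) (F : fieldType)
    (L : {additive 'rV[R]_2 -> 'rV[F]_2}) e s s' :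
  [pchar F] =i pred0 -> (forall v, L v = 0 -> v = 0) ->
  keeps_rational_lengths L -> nsq e = 1 -> s' ^+ 2 = s ^+ 2 + 1 ->
  cross (L (s *: e)) (L (s' *: e)) = 0.
Proof.
move=> F0 L0 Lrat e1 ss'.
pose k := (Num.bound (s' ^+ 2)).+4.
have k_gt : s' ^+ 2 < k%:R.
  apply: (@lt_trans _ _ (Num.bound (s' ^+ 2))%:R); last first.
    by rewrite ltr_nat /k !ltnS !leqW.
  by apply: archi_boundP; rewrite sqr_ge0.
have k_ge4 : 4 <= k%:R :> R by rewrite ler_nat.
have k_neq0 : k%:R != 0 :> R by rewrite pnatr_eq0.
(* As k >= 4, r^2 > k^2/4 >= k > s'^2. *)
have r_gt : 0 < ((k%:R + k%:R^-1) / 2) ^+ 2 - s' ^+ 2.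
  have -> : ((k%:R + k%:R^-1) / 2) ^+ 2 - s' ^+ 2
     = k%:R ^+ 2 / 4 + k%:R ^- 2 / 4 + (2^-1 - s' ^+ 2) by field.
  have : 0 <= k%:R ^- 2 / 4 :> R by rewrite divr_ge0 // invr_ge0 sqr_ge0.
  nra.
pose t := Num.sqrt (((k%:R + k%:R^-1) / 2) ^+ 2 - s' ^+ 2).
have t_neq0 : t != 0 by rewrite gt_eqF // sqrtr_gt0.
have t2 : t ^+ 2 = ((k%:R + k%:R^-1) / 2) ^+ 2 - s' ^+ 2.
  by rewrite sqr_sqrtr ?ltW.
have perp r : dot (r *: e) (t *: turn e) = 0 by coords.
have leg r : nsq (r *: e) + nsq (t *: turn e) = r ^+ 2 + t ^+ 2.
  by transitivity ((r ^+ 2 + t ^+ 2) * nsq e); [coords | rewrite e1 mulr1].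
have dK : (2 * k).-1.+1 = (2 * k)%N by [].
(* The hypotenuses r' and r are (k^2 - 1)/(2k) and (k^2 + 1)/(2k). *)
apply: (@cross_perp _ _ _ (L (t *: turn e))).
- apply/eqP => /L0/(congr1 (fun v => nsq v)); rewrite nsqZ nsq0.
  have -> : nsq (turn e) = nsq e by coords.
  by move/eqP; rewrite e1 mulr1 expf_eq0 /= (negPf t_neq0).
- apply: (perp_rational_hypotenuse (n := (k ^ 2 - 1)%N) (k := (2 * k).-1)) => //.
  rewrite leg t2 ss' dK.
  rewrite natrB ?expn_gt0 // natrX natrM; by field.
- apply: (perp_rational_hypotenuse (n := (k ^ 2 + 1)%N) (k := (2 * k).-1)) => //.
  rewrite leg t2 dK.
  rewrite natrD natrX natrM; by field.
Qed.

(** Applied to 2/(x - 1/x), the last closure gives (x^2 + 1)/(x^2 - 1), whose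
    difference with its inverse is 4/(x^2 - 1/x^2); hence V contains
    x^2 - x^-2 whenever it contains x.  Combining the cases x and x/2 eliminates
    x^-2, so V is closed under squaring, and (a + 1/a)^2 - a^2 - 1/a^2 = 2. *)
Lemma inversion_closed_contains_1 (R : realFieldType) (V : R -> Prop) a :
  (forall s t, V s -> V t -> V (s - t)) -> (forall s, V s -> V s^-1) ->
  (forall s s', V s -> s != 0 -> s' ^+ 2 = s ^+ 2 + 1 -> V s') ->
  V a -> a != 0 -> V 1.
Proof.
move=> VB VV Vsq Va a_neq0.
have V0 : V 0 by rewrite -(subrr a); exact: VB.
have VN s : V s -> V (- s) by move=> Vs; rewrite -sub0r; exact: VB.
have VD s t : V s -> V t -> V (s + t).
  by move=> Vs Vt; rewrite -[t]opprK; apply: VB => //; exact: VN.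
have Vmuln n s : V s -> V (s *+ n).
  by move=> Vs; elim: n => [|n IH]; rewrite ?mulr0n // mulrS; exact: VD.
have Vdivn n s : V (s *+ n.+1) -> V s.
  move=> Vns; have -> : s = ((s *+ n.+1)^-1 *+ n.+1)^-1.
    rewrite -(mulr_natl s n.+1) -(mulr_natl (n.+1%:R * s)^-1).
    by rewrite !invfM !invrK mulKf ?pnatr_eq0.
  by apply/VV/Vmuln/VV.
have Vdouble s : V s -> V (2 * s) by rewrite mulr_natl; exact: Vmuln.
have Vdiff x : V x -> V (x ^+ 2 - x ^- 2).
  move=> Vx; have [->|x_neq0] := eqVneq x 0; first by rewrite expr0n invr0 subr0.
  have [w0|w_neq0] := eqVneq (x - x^-1) 0.
    have -> : x ^+ 2 - x ^- 2 = (x - x^-1) * (x + x^-1) by field.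
    by rewrite w0 mul0r.
  have u_neq0 : x ^+ 2 + 1 != 0 by rewrite gt_eqF // ltr_wpDl ?sqr_ge0.
  have y_neq0 : x ^+ 2 - 1 != 0.
    apply: contra w_neq0 => /eqP e; apply/eqP.
    by transitivity ((x ^+ 2 - 1) / x); [field | rewrite e mul0r].
  have Vb : V (2 * (x - x^-1)^-1) by apply/Vdouble/VV/VB => //; exact: VV.
  have Vc : V ((x ^+ 2 + 1) / (x ^+ 2 - 1)).
    apply: Vsq Vb _ _; first by rewrite mulf_neq0 ?invr_eq0 ?pnatr_eq0.
    by field; rewrite y_neq0 x_neq0.
  have -> : x ^+ 2 - x ^- 2 = 2 * (2 * ((x ^+ 2 + 1) / (x ^+ 2 - 1)
                                 - ((x ^+ 2 + 1) / (x ^+ 2 - 1))^-1)^-1).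
    field; rewrite y_neq0 u_neq0 x_neq0 andbT /=.
    have -> : (x ^+ 2 + 1) * (x ^+ 2 + 1) + - (x ^+ 2 - 1) * (x ^+ 2 - 1)
              = 4 * x ^+ 2 by ring.
    by rewrite mulf_neq0 ?pnatr_eq0 // expf_neq0.
  by apply/Vdouble/Vdouble/VV/VB => //; exact: VV.
have Vsqr x : V x -> V (x ^+ 2).
  move=> Vx; have [->|x_neq0] := eqVneq x 0; first by rewrite expr0n.
  have Vx2 : V (x / 2).
    by apply: (Vdivn 1%N); have -> : x / 2 *+ 2 = x by field.
  apply: (Vdivn 14%N).
  have -> : x ^+ 2 *+ 15 = (x ^+ 2 - x ^- 2) *+ 16
                           - ((x / 2) ^+ 2 - (x / 2) ^- 2) *+ 4 by field.
  by apply: VB; apply/Vmuln/Vdiff.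
have Va' := VV _ Va.
apply: (Vdivn 1%N).
have -> : 1 *+ 2 = (a + a^-1) ^+ 2 - a ^+ 2 - a^-1 ^+ 2 by field.
by apply: (VB); [apply: (VB)|]; apply: (Vsqr) => //; exact: VD.
Qed.

(** For a <> 0 the set of s with L (s e) parallel to L (a e) meets the
    conditions of [inversion_closed_contains_1]. *)
Lemma line_parallel (R : realType) (F : fieldType)
    (L : {additive 'rV[R]_2 -> 'rV[F]_2}) e a :
  [pchar F] =i pred0 -> (forall v, L v = 0 -> v = 0) ->
  keeps_rational_lengths L -> nsq e = 1 -> cross (L e) (L (a *: e)) = 0.
Proof.
move=> F0 L0 Lrat e1.
have e_neq0 : e != 0 by rewrite -nsq_eq0 e1 oner_eq0.
have [->|a_neq0] := eqVneq a 0.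
  by rewrite scale0r raddf0; coords.
have Lneq0 s : s != 0 -> L (s *: e) != 0.
  move=> s_neq0; apply: contraNneq s_neq0 => /L0/eqP.
  by rewrite scaler_eq0 (negPf e_neq0) orbF.
pose V s := cross (L (s *: e)) (L (a *: e)) = 0.
suff : V 1 by rewrite /V scale1r.
have transV s s' : V s -> s != 0 -> cross (L (s *: e)) (L (s' *: e)) = 0 -> V s'.
  by move=> Vs s_neq0 ss'; exact: cross_trans (Lneq0 s s_neq0) ss' Vs.
apply: (@inversion_closed_contains_1 _ V a) => //.
- move=> s t Vs Vt; rewrite /V scalerBl raddfB.
  transitivity (cross (L (s *: e)) (L (a *: e)) - cross (L (t *: e)) (L (a *: e))).
    by coords.
  by rewrite Vs Vt subrr.
- move=> s Vs; have [->|s_neq0] := eqVneq s 0.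
    by rewrite invr0 /V scale0r raddf0; coords.
  apply: (transV s) => //.
  (* s^-1 and s are the sum and the difference of p and q, where p^2 = q^2 + 1 *)
  pose q := (s^-1 - s) / 2; pose p := (s^-1 + s) / 2.
  have qp : cross (L (q *: e)) (L (p *: e)) = 0.
    by apply: line_succ_square => //; rewrite /p /q; field.
  have -> : s *: e = p *: e - q *: e.
    by rewrite -scalerBl; congr (_ *: _); rewrite /p /q; field.
  have -> : s^-1 *: e = p *: e + q *: e.
    by rewrite -scalerDl; congr (_ *: _); rewrite /p /q; field.
  rewrite raddfB raddfD.
  transitivity (- 2 * cross (L (q *: e)) (L (p *: e))); first by coords.
  by rewrite qp mulr0.
- by move=> s s' Vs s_neq0 ss'; apply: (transV s) => //; exact: line_succ_square.
- by rewrite /V; coords.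
Qed.

(** By [line_parallel], dot (L a) (L b) vanishes as soon as it does for unit
    vectors on the two lines, where a 3-4-5 right triangle applies. *)
Lemma additive_perp (R : realType) (F : fieldType)
    (L : {additive 'rV[R]_2 -> 'rV[F]_2}) a b :
  [pchar F] =i pred0 -> (forall v, L v = 0 -> v = 0) ->
  keeps_rational_lengths L -> dot a b = 0 -> dot (L a) (L b) = 0.
Proof.
move=> F0 L0 Lrat ab.
have [->|a_neq0] := eqVneq a 0; first by rewrite raddf0; coords.
have a_gt0 : 0 < nsq a by rewrite lt_def nsq_eq0 a_neq0 nsq_ge0.
pose s := Num.sqrt (nsq a).
have s_neq0 : s != 0 by rewrite gt_eqF // sqrtr_gt0.
have s2 : s ^+ 2 = nsq a by rewrite sqr_sqrtr // ltW.
pose e := s^-1 *: a.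
have e1 : nsq e = 1 by rewrite nsqZ -s2 exprVn mulVf // expf_neq0.
have te1 : nsq (turn e) = 1 by rewrite -e1; coords.
have aE : a = s *: e by rewrite scalerA mulfV // scale1r.
have bE : b = dot b (turn e) *: turn e.
  have eb : dot b e = 0.
    by apply: (mulfI s_neq0); rewrite mulr0 -ab aE; coords.
  have bE' : nsq e *: b = dot b e *: e + dot b (turn e) *: turn e.
    by apply: row2P; coords.
  by rewrite -[LHS]scale1r -e1 bE' eb scale0r add0r.
have neq0 v : nsq v = 1 -> L v != 0.
  by move=> v1; apply/eqP => /L0 v0; move/eqP: v1; rewrite v0 nsq0 eq_sym oner_eq0.
have unit_perp : dot (L e) (L (turn e)) = 0.
  have leg345 : dot (L (3 *: e)) (L (4 *: turn e)) = 0.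
    apply: (@perp_rational_hypotenuse _ _ L 5 0) => //; first by coords.
    by rewrite (nsqZ 3) (nsqZ 4) e1 te1; field.
  have twelve : 12 != 0 :> F by exact: pchar0_natr_neq0.
  apply: (mulfI twelve); rewrite mulr0 -leg345 !scaler_nat.
  rewrite !mulrS !mulr0n !raddfD raddf0; coords.
rewrite aE bE.
apply: (dot_parallel (neq0 _ e1)); first exact: line_parallel.
rewrite dotC; apply: (dot_parallel (neq0 _ te1)); first exact: line_parallel.
by rewrite dotC.
Qed.

(** * Perpendicularity *)

Theorem theorem9 (R : realType) (F : fieldType) (charF0 : [pchar F] =i pred0)
    (f : 'rV[R]_2 -> 'rV[F]_2) (f_unit : preserves_unit_distance f)
    (P Q X Y : 'rV[R]_2) :
  perpendicular (Q - P) (Y - X) -> perpendicular (f Q - f P) (f Y - f X).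
Proof.
have f_unit' : unit_preserving f.
  move=> x y xy; rewrite -phi2E; apply: f_unit.
  by rewrite /euclidean_dist -/(phi2 x y) phi2E xy sqrtr1.
have [L [fL L0 Lrat]] := unit_preserving_affine charF0 f_unit'.
rewrite /perpendicular !fL; exact: additive_perp.
Qed.
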